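(* Let $\mathcal{D}=(d,1]$ for some $d>0$. Then $\Gamma\models^\mathcal{D}_\mathsf{biG}\chi$ iff $\Gamma\models^\leq_\mathsf{biG}\chi$.
   Context: Bi-Gödel logic $\mathsf{biG}$: formulas are built from propositional variables and $\mathbf{0},\mathbf{1}$ with ${\sim},\triangle,\wedge,\vee,\rightarrow$ and co-implication $-\!<$. A valuation $v$ maps variables to $[0,1]$ and is extended by $v(\mathbf{0})=0$, $v(\mathbf{1})=1$, $\min$ for $\wedge$, $\max$ for $\vee$, $v(\phi\rightarrow\chi)=1$ if $v(\phi)\leq v(\chi)$ else $v(\chi)$, $v(\phi-\!<\chi)=0$ if $v(\phi)\leq v(\chi)$ else $v(\phi)$, $v({\sim}\phi)=1$ iff $v(\phi)=0$ (else $0$), $v(\triangle\phi)=1$ iff $v(\phi)=1$ (else $0$). For a filter $\mathcal{D}$ on $[0,1]$ (non-empty proper subset closed under $\min$ and upward closed), $\Gamma\models^\mathcal{D}_\mathsf{biG}\chi$ iff for every $v$, $\inf\{v(\phi)\mid\phi\in\Gamma\}\in\mathcal{D}$ implies $v(\chi)\in\mathcal{D}$. $\Gamma\models^\leq_\mathsf{biG}\chi$ iff $\inf\{v(\phi)\mid\phi\in\Gamma\}\leq v(\chi)$ for every $v$. *)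

(* Defs.v *)
From HB Require Import structures.
From mathcomp Require Import all_boot all_order all_algebra.
From mathcomp Require Import all_classical all_reals.

Set Implicit Arguments.
Unset Strict Implicit.
Unset Printing Implicit Defensive.

Import Order.TTheory GRing.Theory Num.Theory.
Local Open Scope classical_set_scope.
Local Open Scope ring_scope.

Inductive biG_formula (V : Type) : Type :=
| Var of V
| Zero
| One
| Neg of biG_formula V
| Delta of biG_formula V
| And of biG_formula V & biG_formula V
| Or of biG_formula V & biG_formula V
| Imp of biG_formula V & biG_formula V
| Coimp of biG_formula V & biG_formula V.

Arguments Zero {V}.
Arguments One {V}.

Section Semantics.
Variables (R : realType) (V : Type).
Implicit Types (v : V -> R) (D A : set R).
Implicit Types (Gamma : set (biG_formula V)) (chi : biG_formula V).

Definition is_valuation v := forall p, v p \in `[0, 1].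

Fixpoint eval v (phi : biG_formula V) : R :=
  match phi with
  | Var p => v p
  | Zero => 0
  | One => 1
  | Neg a => if eval v a == 0 then 1 else 0
  | Delta a => if eval v a == 1 then 1 else 0
  | And a b => Num.min (eval v a) (eval v b)
  | Or a b => Num.max (eval v a) (eval v b)
  | Imp a b => if eval v a <= eval v b then 1 else eval v b
  | Coimp a b => if eval v a <= eval v b then 0 else eval v a
  end.

(* The infimum in the complete lattice [0, 1]; in particular the infimum of the
   empty set is 1, whereas [inf set0 = 0]. *)
Definition inf01 A : R := inf (1 |` A).

Lemma inf01_glb A x : A `<=` `[0, 1] -> x \in `[0, 1] ->
  x <= inf01 A <-> lbound A x.
Proof.
move=> A01; rewrite in_itv /= => /andP[x0 x1].
have lb0 : has_lbound (1 |` A).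
  exists 0 => y [->|/A01 /=]; first exact: ler01.
  by rewrite in_itv /= => /andP[].
split=> [xA y Ay|xA].
  by apply: (le_trans xA); apply: ge_inf => //; right.
apply: lb_le_inf; first by exists 1; left.
by move=> y [->|/xA].
Qed.

Lemma inf01_itv A : A `<=` `[0, 1] -> inf01 A \in `[0, 1].
Proof.
move=> A01; rewrite in_itv /=; apply/andP; split.
  apply/inf01_glb => //; first by rewrite in_itv /= lexx ler01.
  by move=> y /A01 /=; rewrite in_itv /= => /andP[].
apply: ge_inf; last by left.
exists 0 => y [->|/A01 /=]; first exact: ler01.
by rewrite in_itv /= => /andP[].
Qed.

Definition is_filter01 D :=
  [/\ D `<=` `[0, 1], D !=set0, D <> `[0, 1]%classic,
      (forall x y, D x -> D y -> D (Num.min x y)) &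
      (forall x y, D x -> x <= y -> y <= 1 -> D y)].

Definition entails_filter D Gamma chi :=
  forall v, is_valuation v -> D (inf01 (eval v @` Gamma)) -> D (eval v chi).

End Semantics.

Definition entails_le (R : realType) (V : Type)
    (Gamma : set (biG_formula V)) (chi : biG_formula V) :=
  forall v : V -> R, is_valuation v -> inf01 (eval v @` Gamma) <= eval v chi.

(* Main.v *)
(* If [chi] is evaluated to [c], strictly below the infimum of [Gamma], compose
   the valuation with a strictly increasing self-map of [0, 1] that fixes 0 and
   1, sends [c] to at most [d] and everything above [c] strictly above [d].
   Such maps commute with all biG connectives, so the composed valuation refutes
   the [D]-entailment; the map need not be continuous, because a monotone map
   sends lower bounds to lower bounds. *)
Require Import Defs.
From HB Require Import structures.
From mathcomp Require Import all_boot all_order all_algebra.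
From mathcomp Require Import all_classical all_reals.
From mathcomp Require Import lra.

Set Implicit Arguments.
Unset Strict Implicit.
Unset Printing Implicit Defensive.

Import Order.TTheory GRing.Theory Num.Theory.
Local Open Scope classical_set_scope.
Local Open Scope ring_scope.

Lemma eval_itv (R : realType) (V : Type) (v : V -> R) (phi : biG_formula V) :
  is_valuation v -> eval v phi \in `[0, 1].
Proof.
move=> v01; elim: phi => [p|||a|a|a IHa b IHb|a IHa b IHb|a _ b IHb|a IHa b _] /=;
  rewrite ?in_itv /= ?lexx ?ler01 //.
- exact: v01.
- by case: ifP; rewrite lexx ler01.
- by case: ifP; rewrite lexx ler01.
- by case: (leP (eval v a) (eval v b)).
- by case: (leP (eval v a) (eval v b)).
- by case: ifP => _; [rewrite lexx ler01|exact: IHb].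
- by case: ifP => _; [rewrite lexx ler01|exact: IHa].
Qed.

Lemma eval_image_itv (R : realType) (V : Type) (v : V -> R)
    (Gamma : set (biG_formula V)) :
  is_valuation v -> eval v @` Gamma `<=` `[0, 1].
Proof. by move=> v01 _ [phi _ <-]; exact: eval_itv. Qed.

(** Each connective returns 0, 1 or one of its arguments, and chooses by comparing values with each
    other or with 0 and 1. An order embedding fixing 0 and 1 preserves these choices; its
    injectivity handles the equality tests of [Neg] and [Delta]. *)
Lemma eval_comp (R : realType) (V : Type) (h : R -> R) (v : V -> R)
    (phi : biG_formula V) :
  {mono h : x y / x <= y} -> h 0 = 0 -> h 1 = 1 ->
  eval (h \o v) phi = h (eval v phi).
Proof.
move=> hle h0 h1; have hinj : injective h := inc_inj hle.
elim: phi => [p|||a IHa|a IHa|a IHa b IHb|a IHa b IHb|a IHa b IHb|a IHa b IHb] //=.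
- by rewrite IHa -{1}h0 (inj_eq hinj); case: ifP.
- by rewrite IHa -{1}h1 (inj_eq hinj); case: ifP.
- by rewrite IHa IHb !minEle hle; case: ifP.
- by rewrite IHa IHb !maxEle hle; case: ifP.
- by rewrite IHa IHb hle; case: ifP.
- by rewrite IHa IHb hle; case: ifP.
Qed.

Section Stretch.
Variables (R : realType) (c d : R).
Hypotheses (c_ge0 : 0 <= c) (c_lt1 : c < 1) (d_gt0 : 0 < d) (d_lt1 : d < 1).

(** Two lines, through (0, 0) and (1, 1), with an upward jump just after [c]. Both extend to all of
    [R], so monotonicity needs no restriction to the unit interval. *)
Definition stretch (x : R) : R := if x <= c then d * x else d + (1 - d) * x.

Lemma stretch_mono : {mono stretch : x y / x <= y}.
Proof.
apply: le_mono => x y xy; rewrite /stretch.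
case: (leP x c) => xc; case: (leP y c) => yc.
- by rewrite ltr_pM2l.
(* Across the jump, the difference of the two values is exactly the sum of these two positive
   terms. *)
- have : 0 < d * (1 - x) by rewrite mulr_gt0 // subr_gt0 (le_lt_trans xc).
  have : 0 < (1 - d) * y by rewrite mulr_gt0 ?subr_gt0 // (le_lt_trans c_ge0).
  lra.
- lra.
- by rewrite ltrD2l ltr_pM2l // subr_gt0.
Qed.

Lemma stretch0 : stretch 0 = 0.
Proof. by rewrite /stretch c_ge0 mulr0. Qed.

Lemma stretch1 : stretch 1 = 1.
Proof. by rewrite /stretch leNgt c_lt1 /=; lra. Qed.

Lemma stretch_le : stretch c <= d.
Proof. by rewrite /stretch lexx ler_piMr // ltW. Qed.

Lemma stretch_gt x : c < x -> d < stretch x.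
Proof.
move=> cx; rewrite /stretch leNgt cx /= ltrDl mulr_gt0 ?subr_gt0 //.
exact: le_lt_trans cx.
Qed.

End Stretch.

Theorem theorem2 (R : realType) (V : Type) (D : set R) (d : R)
    (D_filter : is_filter01 D) (d_gt0 : 0 < d)
    (D_def : D = `]d, 1]%classic)
    (Gamma : set (biG_formula V)) (chi : biG_formula V) :
  entails_filter D Gamma chi <-> entails_le R Gamma chi.
Proof.
(* The filter is non-empty, so some point lies in []d, 1]]. *)
have d_lt1 : d < 1.
  case: D_filter => _ [x]; rewrite D_def /= in_itv /= => /andP[dx x1] _ _ _.
  exact: lt_le_trans dx x1.
subst D; split=> [ent v v01|ent v v01]; last first.
  rewrite /= !in_itv /= => /andP[dinf _].
  have /andP[_ chi_le1] : 0 <= eval v chi <= 1 := eval_itv chi v01.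
  by rewrite chi_le1 (lt_le_trans dinf (ent v v01)).
rewrite leNgt; apply/negP; set c := eval v chi; set i := inf01 _ => ci.
have /andP[c0 _] : 0 <= c <= 1 := eval_itv chi v01.
have i01 : i \in `[0, 1] := inf01_itv (eval_image_itv v01).
have /andP[_ i1] : 0 <= i <= 1 := i01.
have c1 : c < 1 := lt_le_trans ci i1.
pose h := stretch c d.
have hle : {mono h : x y / x <= y} := stretch_mono c0 c1 d_gt0 d_lt1.
have h0 : h 0 = 0 := stretch0 d c0.
have h1 : h 1 = 1 := stretch1 d c1.
have h01 x : (h x \in `[0, 1]) = (x \in `[0, 1]).
  by rewrite !in_itv /= -{1}h0 -{1}h1 !hle.
have hv01 : is_valuation (h \o v) by move=> p; rewrite h01.
have hi_le : h i <= inf01 (eval (h \o v) @` Gamma).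
  apply/inf01_glb; [exact: eval_image_itv|by rewrite h01|].
  move=> _ [phi Gphi <-]; rewrite eval_comp // hle.
  (* Taking [i] itself as the candidate bound shows that [i] is a lower bound of the original
     values. *)
  have [/(_ (lexx i)) i_lb _] :=
    inf01_glb (eval_image_itv (Gamma := Gamma) v01) i01.
  by apply: i_lb; exists phi.
have /= := ent _ hv01; rewrite !in_itv /= eval_comp //.
have /andP[_ ->] : 0 <= inf01 (eval (h \o v) @` Gamma) <= 1.
  exact: inf01_itv (eval_image_itv hv01).
(* Since [c < i], the new infimum is at least [h i > d] and so lies in the filter, whereas [chi] now
   has value [h c <= d]. *)
rewrite (lt_le_trans (stretch_gt c0 d_lt1 ci) hi_le) => /(_ isT).
by rewrite ltNge (stretch_le c1 d_gt0).
Qed.
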